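(* Let $\mathbf{M}$ be an $m\times n$ interval matrix with center $M^C$ and radius $M^\Delta$, and let $M^R\in\mathbb{R}^{(m-1)\times(n-1)}$ be the residual matrix of $M^C$, i.e. $m^R_{ij}=m^C_{i+1,j}+m^C_{i,j+1}-m^C_{ij}-m^C_{i+1,j+1}$. If for all $1\le i\le m$, $1\le j\le n$ it holds that $$m^\Delta_{ij}\ge\Big|\sum_{k=i}^{m-1}\sum_{\ell=j}^{n-1}m^R_{k\ell}\Big|,$$ then $\mathbf{M}$ has the weak Monge property.
   Context: An interval matrix $\mathbf{M}=[\underline{M},\overline{M}]$ with real $m\times n$ matrices $\underline{M}\le\overline{M}$ is the set $\{A\in\mathbb{R}^{m\times n}:\underline{M}\le A\le\overline{M}\}$ (entrywise). Its center is $M^C=\frac12(\underline{M}+\overline{M})$ and radius $M^\Delta=\frac12(\overline{M}-\underline{M})$. Empty sums are $0$. A real matrix $A$ is Monge if $a_{ij}+a_{k\ell}\le a_{i\ell}+a_{kj}$ for all $i<k$, $j<\ell$. $\mathbf{M}$ has the weak Monge property if it contains a Monge matrix. *)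

(* Defs.v *)
From HB Require Import structures.
From mathcomp Require Import all_boot all_order all_algebra reals.

Set Implicit Arguments.
Unset Strict Implicit.
Unset Printing Implicit Defensive.

Import Order.TTheory GRing.Theory Num.Theory.
Local Open Scope ring_scope.

Section IntervalMatrix.
Variable R : realType.

Record interval_matrix (m n : nat) := IntervalMatrix {
  im_lower : 'M[R]_(m, n);
  im_upper : 'M[R]_(m, n);
  im_lower_le_upper : forall i j, im_lower i j <= im_upper i j
}.

Definition in_interval_matrix m n (A : 'M[R]_(m, n))
    (M : interval_matrix m n) : Prop :=
  forall i j, im_lower M i j <= A i j <= im_upper M i j.

Definition im_center m n (M : interval_matrix m n) : 'M[R]_(m, n) :=
  2^-1 *: (im_lower M + im_upper M).

Definition im_radius m n (M : interval_matrix m n) : 'M[R]_(m, n) :=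
  2^-1 *: (im_upper M - im_lower M).

Definition monge m n (A : 'M[R]_(m, n)) : Prop :=
  forall (i k : 'I_m) (j l : 'I_n), (i < k)%N -> (j < l)%N ->
    A i j + A k l <= A i l + A k j.

Definition weak_monge m n (M : interval_matrix m n) : Prop :=
  exists A : 'M[R]_(m, n), in_interval_matrix A M /\ monge A.

(* For i : 'I_m, the two indices of 'I_m.+1 with values i and i.+1 are
   [widen_ord (leqnSn m) i] and [lift ord0 i]. *)
Definition residual m n (A : 'M[R]_(m.+1, n.+1)) : 'M[R]_(m, n) :=
  \matrix_(i < m, j < n)
    let i0 := widen_ord (leqnSn m) i in let i1 := lift ord0 i in
    let j0 := widen_ord (leqnSn n) j in let j1 := lift ord0 j in
    A i1 j0 + A i0 j1 - A i0 j0 - A i1 j1.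

End IntervalMatrix.

(* Main.v *)
(* Adding to the center C the matrix of partial sums S of its residuals leaves
   a matrix inside M, because |S i j| is at most the radius.  These double sums
   telescope to S i j = C m j + C i n - C i j - C m n, so (C + S) i j =
   C m j + C i n - C m n is a sum of a function of i and a function of j, and
   satisfies every Monge inequality with equality. *)
Require Import Defs.
From HB Require Import structures.
From mathcomp Require Import all_boot all_order all_algebra reals.
From mathcomp Require Import ring lra.

Set Implicit Arguments.
Unset Strict Implicit.
Unset Printing Implicit Defensive.

Import Order.TTheory GRing.Theory Num.Theory.
Local Open Scope ring_scope.

Lemma telescope_ord_sumr (V : zmodType) (m : nat) (f : 'I_m.+1 -> V)
    (i : 'I_m.+1) :
  \sum_(k < m | (i <= k)%N) (f (lift ord0 k) - f (widen_ord (leqnSn m) k))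
  = f ord_max - f i.
Proof.
pose g k := f (inord k).
have -> : f ord_max - f i = g m - g i.
  by rewrite /g inord_val; congr (f _ - _); apply: val_inj; rewrite /= inordK.
have le_im : (i <= m)%N by rewrite -ltnS.
rewrite -(telescope_sumr g le_im) big_geq_mkord.
apply: eq_bigr => k _; rewrite /g.
by congr (f _ - f _); apply: val_inj; rewrite /= inordK // ltnS ?(ltnW (ltn_ord k)) ?ltn_ord.
Qed.

(** A residual is a mixed second difference, so the sum telescopes along columns ([g]), then along
    rows ([f]). *)
Lemma sum_residual (R : realType) (m n : nat) (A : 'M[R]_(m.+1, n.+1))
    (i : 'I_m.+1) (j : 'I_n.+1) :
  \sum_(k < m | (i <= k)%N) \sum_(l < n | (j <= l)%N) residual A k l
  = A ord_max j + A i ord_max - A i j - A ord_max ord_max.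
Proof.
pose f k := A k j - A k ord_max.
transitivity (f ord_max - f i); last by rewrite /f; ring.
rewrite -telescope_ord_sumr; apply: eq_bigr => k _.
pose g l := A (widen_ord (leqnSn m) k) l - A (lift ord0 k) l.
transitivity (g ord_max - g j); last by rewrite /f /g; ring.
rewrite -telescope_ord_sumr; apply: eq_bigr => l _.
by rewrite mxE /g; ring.
Qed.

Theorem theorem4p2 (R : realType) (m n : nat)
    (M : interval_matrix R m.+1 n.+1)
    (hrad : forall (i : 'I_m.+1) (j : 'I_n.+1),
      `| \sum_(k < m | (i <= k)%N) \sum_(l < n | (j <= l)%N)
           residual (im_center M) k l | <= im_radius M i j) :
  weak_monge M.
Proof.
pose C := im_center M.
exists (\matrix_(i, j) (C ord_max j + C i ord_max - C ord_max ord_max)).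
split=> [i j|i k j l _ _]; last by rewrite !mxE; lra.
move: (hrad i j); rewrite sum_residual -/C ler_norml.
have Cij : C i j = 2^-1 * (im_lower M i j + im_upper M i j) by rewrite !mxE.
have Dij : im_radius M i j = 2^-1 * (im_upper M i j - im_lower M i j).
  by rewrite !mxE.
(* The witness minus [C] is the bounded sum, and center minus or plus radius gives the interval's
   endpoints. *)
rewrite Dij Cij => /andP[lo hi]; rewrite mxE; apply/andP; split; lra.
Qed.
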